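(* Any second order $\mathrm{SE}(n+1)$-invariant PDE for hypersurfaces $S_f=\{u=f(\boldsymbol{x})\}$ in the Euclidean space $\mathbb{E}^{n+1}$ which is polynomial in the second order derivatives of $f$ is of the form $$F\left(\mathrm{trace}(A_{\boldsymbol{p}}),\mathrm{trace}(A_{\boldsymbol{p}}^2),\dots,\mathrm{trace}(A_{\boldsymbol{p}}^n)\right)=0 ,$$ where $F$ is a polynomial of $n$ variables and $A_{\boldsymbol{p}}$ is the shape operator of the hypersurface at its point $\boldsymbol{p}$.
   Context: $\mathbb{E}^{n+1}=\mathrm{SE}(n+1)/\mathrm{SO}(n+1)$ is Euclidean space with orthonormal coordinates $(u,\boldsymbol{x})=(u,x^1,\dots,x^n)$, and $\mathrm{SE}(n+1)=\mathbb{R}^{n+1}\rtimes\mathrm{SO}(n+1)$ is the group of orientation-preserving motions. $J^2=J^2(n,\mathbb{E}^{n+1})$ denotes the manifold of $2$-jets $[S]^2_{\boldsymbol{p}}$ of hypersurfaces $S\subset\mathbb{E}^{n+1}$ (equivalence classes of hypersurfaces through $\boldsymbol{p}$ whose local graph functions have the same Taylor expansion up to order $2$), with coordinates $(u,x^i,u_i,u_{ij})$, where $u_i([S_f]^2_{\boldsymbol{p}})=\partial_i f(\boldsymbol{x})$, $u_{ij}([S_f]^2_{\boldsymbol{p}})=\partial_i\partial_jf(\boldsymbol{x})$. A motion $\phi$ acts on $J^2$ by $[S]^2_{\boldsymbol{p}}\mapsto[\phi(S)]^2_{\phi(\boldsymbol{p})}$. A second order (scalar) PDE is a hypersurface (submanifold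 of codimension one) $\mathcal{E}\subset J^2$; it is $\mathrm{SE}(n+1)$-invariant if $\mathrm{SE}(n+1)\cdot\mathcal{E}=\mathcal{E}$; its solutions are the hypersurfaces $S$ with $[S]^2_{\boldsymbol{p}}\in\mathcal{E}$ for all $\boldsymbol{p}\in S$. It is polynomial in the second order derivatives if it is the zero set of a function that is polynomial in the $u_{ij}$. The shape operator is $A=g^{-1}\circ\beta$, where, for $S_f$, $g=(\delta_{ij}+u_iu_j)dx^idx^j$ is the first fundamental form and $\beta=\frac{u_{ij}}{\sqrt{\det g}}dx^idx^j$, $\det g=1+\sum_i u_i^2$, is the second fundamental form; $A_{\boldsymbol{p}}$ depends only on $[S_f]^2_{\boldsymbol{p}}$. ''Of the form $F(\dots)=0$'' means that $\mathcal{E}$ is (in the coordinates above) the set of $2$-jets $[S_f]^2_{\boldsymbol{p}}$ satisfying that equation. *)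

(* Defs.v *)
From HB Require Import structures.
From Stdlib Require Import Relation_Operators.
From mathcomp Require Import all_boot all_order all_algebra generic_quotient.
From mathcomp Require Import boolp classical_sets functions reals topology.
From mathcomp Require Import normedtype derive.
From mathcomp Require mpoly.

Set Implicit Arguments.
Unset Strict Implicit.
Unset Printing Implicit Defensive.

Import Order.TTheory GRing.Theory Num.Theory numFieldNormedType.Exports.
Local Open Scope classical_set_scope.
Local Open Scope quotient_scope.
Local Open Scope ring_scope.

(* Smoothness of a real function on an open set U: all iterated directional
   derivatives exist on U and are (Frechet) differentiable there. *)
Fixpoint Ck (R : realType) (V : normedModType R) (k : nat) (U : set V)
    (f : V -> R) : Prop :=
  match k with
  | 0 => forall x, U x -> {for x, continuous f}
  | k'.+1 => (forall x, U x -> differentiable f x) /\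
             (forall v, Ck k' U (fun x => 'D_v f x))
  end.

Definition smooth_on (R : realType) (V : normedModType R) (U : set V)
    (f : V -> R) : Prop :=
  forall k, Ck k U f.

Section Euclidean.
Variables (R : realType) (n : nat).

(* A point of E^(n+1) is the column col_mx u x of its coordinates (u, x). *)
Definition point := 'cV[R]_(1 + n).

(* Elements of SE(n+1); they also serve as the positively oriented orthonormal
   coordinate systems of E^(n+1), a motion sending coordinates to points. *)
Record motion := Motion {
  rot : 'M[R]_(1 + n);
  trans : point;
  rot_orth : rot *m rot^T = 1%:M;
  rot_det : \det rot = 1 }.

Definition move (phi : motion) (p : point) : point :=
  rot phi *m p + trans phi.

Lemma motion1_orth : (1%:M : 'M[R]_(1 + n)) *m 1%:M^T = 1%:M.
Proof. by rewrite trmx1 mulmx1. Qed.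

Lemma motion1_det : \det (1%:M : 'M[R]_(1 + n)) = 1.
Proof. exact: det1. Qed.

Definition motion1 : motion := Motion 0 motion1_orth motion1_det.

Lemma move1 p : move motion1 p = p.
Proof. by rewrite /move mul1mx addr0. Qed.

Lemma motionM_orth (phi psi : motion) :
  (rot phi *m rot psi) *m (rot phi *m rot psi)^T = 1%:M.
Proof.
by rewrite trmx_mul mulmxA -(mulmxA (rot phi)) rot_orth mulmx1 rot_orth.
Qed.

Lemma motionM_det (phi psi : motion) : \det (rot phi *m rot psi) = 1.
Proof. by rewrite det_mulmx !rot_det mulr1. Qed.

Definition motionM (phi psi : motion) : motion :=
  Motion (move phi (trans psi)) (motionM_orth phi psi) (motionM_det phi psi).

Lemma moveM phi psi p : move (motionM phi psi) p = move phi (move psi p).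
Proof. by rewrite /move /= mulmxDr mulmxA addrA. Qed.

Lemma move_inj phi : injective (move phi).
Proof.
move=> p q /addIr /(congr1 (mulmx (rot phi)^T)).
by rewrite !mulmxA (mulmx1C (rot_orth phi)) !mul1mx.
Qed.

(* Smooth functions defined on an open subset of R^n. *)
Record lfun := LFun {
  dom : set 'cV[R]_n;
  fn :> 'cV[R]_n -> R;
  dom_open : open dom;
  fn_smooth : smooth_on dom fn }.

Definition gpoint (f : lfun) (x : 'cV[R]_n) : point := col_mx (f x)%:M x.

(* The hypersurface S_f = {u = f(x)}. *)
Definition graph (f : lfun) : set point := [set gpoint f x | x in dom f].

Definition partial (i : 'I_n) (f : 'cV[R]_n -> R) (x : 'cV[R]_n) : R :=
  'D_(delta_mx i 0) f x.

(* Values of the coordinates ((u, x), u_i, u_ij) of a 2-jet. *)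
Definition jcoords := (point * 'cV[R]_n * 'M[R]_n)%type.

Definition coords (f : lfun) (x : 'cV[R]_n) : jcoords :=
  (gpoint f x,
   \col_i partial i f x,
   \matrix_(i, j) partial i (partial j f) x).

(* In the Euclidean coordinates psi, the set S coincides near the point with
   coordinates gpoint f x with the graph of f. *)
Definition local_graph (S : set point) (psi : motion) (f : lfun)
    (x : 'cV[R]_n) : Prop :=
  dom f x /\ \forall q \near gpoint f x, S (move psi q) <-> graph f q.

Definition hypersurface (S : set point) : Prop :=
  forall p, S p -> exists psi f x,
    p = move psi (gpoint f x) /\ local_graph S psi f x.

Lemma hypersurface_graph (f : lfun) : hypersurface (graph f).
Proof.
move=> p [x fx <-]; exists motion1, f, x; split; first by rewrite move1.
by split=> //; near=> q; rewrite move1.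
Unshelve. all: by end_near.
Qed.

Lemma hypersurface_move (phi : motion) (S : set point) :
  hypersurface S -> hypersurface (move phi @` S).
Proof.
move=> hS _ [p Sp <-]; have [psi [f [x [-> [fx Sf]]]]] := hS p Sp.
exists (motionM phi psi), f, x; split; first by rewrite moveM.
split=> //; apply: filterS Sf => q <-; rewrite moveM.
split=> [[p' Sp' /move_inj <-]//|Sq]; by exists (move psi q).
Qed.

Record pointed := Pointed {
  carrier : set point;
  base : point;
  carrier_hyp : hypersurface carrier;
  carrier_base : carrier base }.

(* S and S' pass through the same point, near which, in suitable common
   Euclidean coordinates, they are graphs of functions with the same Taylor
   expansion up to order 2. *)
Definition same_jet (s s' : pointed) : Prop :=
  exists psi f f' x,
    [/\ base s = move psi (gpoint f x), local_graph (carrier s) psi f x,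
        base s' = move psi (gpoint f' x), local_graph (carrier s') psi f' x
      & coords f x = coords f' x].

HB.instance Definition _ := gen_eqMixin pointed.
HB.instance Definition _ := gen_choiceMixin pointed.

(* same_jet is already an equivalence relation, but its transitivity requires
   the implicit function theorem (to pass from one coordinate system to
   another); generating an equivalence from it avoids that proof and does not
   change the relation. *)
Definition jet_eq (s s' : pointed) : bool :=
  `[< clos_refl_sym_trans _ same_jet s s' >].

Lemma jet_eq_refl : reflexive jet_eq.
Proof. by move=> s; apply/asboolP; exact: rst_refl. Qed.

Lemma jet_eq_sym : symmetric jet_eq.
Proof. by move=> s t; apply/asboolP/asboolP; exact: rst_sym. Qed.

Lemma jet_eq_trans : transitive jet_eq.
Proof.
move=> t s w /asboolP st /asboolP tw; apply/asboolP; exact: rst_trans st tw.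
Qed.

Canonical jet_equiv := EquivRel jet_eq jet_eq_refl jet_eq_sym jet_eq_trans.

(* The set J^2(n, E^(n+1)). *)
Definition J2 := {eq_quot jet_equiv}.

Definition jet (s : pointed) : J2 := \pi_J2 s.

Definition move_pointed (phi : motion) (s : pointed) : pointed :=
  Pointed (hypersurface_move (phi := phi) (@carrier_hyp s))
          (imageP (move phi) (@carrier_base s)).

Definition jact (phi : motion) (j : J2) : J2 := jet (move_pointed phi (repr j)).

Lemma same_jet_move phi s s' :
  same_jet s s' -> same_jet (move_pointed phi s) (move_pointed phi s').
Proof.
have lgM S psi f x : local_graph S psi f x ->
    local_graph (move phi @` S) (motionM phi psi) f x.
  move=> [fx Sf]; split=> //; apply: filterS Sf => q <-; rewrite moveM.
  split=> [[p' Sp' /move_inj <-]//|Sq]; by exists (move psi q).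
move=> [psi [f [f' [x [bs sf bs' sf' eqc]]]]].
exists (motionM phi psi), f, f', x; split.
- by rewrite /= bs moveM.
- exact: lgM sf.
- by rewrite /= bs' moveM.
- exact: lgM sf'.
- exact: eqc.
Qed.

Lemma jact_jet phi s : jact phi (jet s) = jet (move_pointed phi s).
Proof.
have clM a b : clos_refl_sym_trans _ same_jet a b ->
    clos_refl_sym_trans _ same_jet (move_pointed phi a) (move_pointed phi b).
  elim=> [s1 s2 /(same_jet_move phi)|s1|s1 s2 _|s1 s2 s3 _ h1 _ h2].
  - exact: rst_step.
  - exact: rst_refl.
  - exact: rst_sym.
  - exact: rst_trans h1 h2.
apply/eqmodP/asboolP/clM/asboolP.
by have /eqmodP : \pi_J2 (repr (jet s)) = \pi_J2 s := reprK (jet s).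
Qed.

Lemma graph_base (f : lfun) (x : 'cV[R]_n) : dom f x -> graph f (gpoint f x).
Proof. by move=> fx; exists x. Qed.

(* The 2-jet of S_f at the point of S_f over x. *)
Definition jet_graph (f : lfun) (x : 'cV[R]_n) (fx : dom f x) : J2 :=
  jet (Pointed (hypersurface_graph (f := f)) (graph_base fx)).

(* J^2 has the smooth atlas consisting of the standard chart (u, x, u_i, u_ij),
   whose domain is the set of jets of graphs, and of its translates by motions.
   in_chart E psi is the image of E under the chart translated by psi; it lies
   in the subspace of the jcoords with symmetric u_ij, which is the model space
   of the manifold J^2. *)
Definition in_chart (E : set J2) (psi : motion) : set jcoords :=
  [set c | exists f x (fx : dom f x),
     c = coords f x /\ E (jact psi (jet_graph fx))].

Definition sym_coords : set jcoords := [set c | c.2^T = c.2].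

(* E is a submanifold of codimension one of J^2: in each chart it is locally
   the zero set of a smooth function whose differential on the model space does
   not vanish. *)
Definition second_order_PDE (E : set J2) : Prop :=
  forall psi c, in_chart E psi c ->
    exists (W : set jcoords) (G : jcoords -> R),
      [/\ open W, W c, smooth_on W G,
          (forall c', W c' -> sym_coords c' -> (in_chart E psi c' <-> G c' = 0))
        & exists2 v, sym_coords v & 'D_v G c != 0].

Definition SE_invariant (E : set J2) : Prop :=
  [set jact phi j | phi in [set: motion] & j in E] = E.

(* In the coordinates (u, x, u_i, u_ij), E is the zero set of a function which
   is polynomial in the u_ij: P gives, for each value of ((u, x), u_i), a
   polynomial (of bounded degree) in n * n variables, the variable number
   mxvec_index i j standing for u_ij. *)
Definition polynomial_in_second_derivatives (E : set J2) : Prop :=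
  exists (d : nat) (P : point * 'cV[R]_n -> mpoly.mpoly (n * n) R),
    (forall c m, (d < mpoly.mdeg m)%N -> mpoly.mcoeff m (P c) = 0) /\
    forall f x (fx : dom f x),
      E (jet_graph fx) <->
      mpoly.meval (mxvec (coords f x).2 0) (P (coords f x).1) = 0.

Definition first_form (c : jcoords) : 'M[R]_n := 1%:M + c.1.2 *m c.1.2^T.

Definition second_form (c : jcoords) : 'M[R]_n :=
  (Num.sqrt (\det (first_form c)))^-1 *: c.2.

Definition shape_operator (f : lfun) (x : 'cV[R]_n) : 'M[R]_n :=
  invmx (first_form (coords f x)) *m second_form (coords f x).

End Euclidean.

(* Main.v *)
Require Import Defs.
From mathcomp Require Import all_boot all_order all_algebra fingroup perm.
From mathcomp Require Import boolp classical_sets reals ring.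
From mathcomp Require mpoly complex.

Set Implicit Arguments.
Unset Strict Implicit.
Unset Printing Implicit Defensive.

Import Order.TTheory GRing.Theory Num.Theory.
Local Open Scope ring_scope.

(** Let [E] be invariant and given by polynomials [P_c] in the second derivatives,
    where [c] runs over the possible values of point and gradient.

    Motions act transitively on the pairs (point, tangent hyperplane), so [E] is
    determined by its fibre over the origin with horizontal tangent hyperplane. In
    adapted coordinates the 2-jet of [f] becomes [(0, 0, W)], where [W]
    ([frame_operator]) is the matrix of the shape operator in an orthonormal frame
    of the tangent hyperplane. By the spectral theorem ([symmetric_spectral]) a
    further rotation makes [W] diagonal, with the principal curvatures [l] in any
    order on the diagonal; a reflection can be avoided by changing the sign of one
    basis vector. So, with [P] the polynomial over the origin with gradient zero
    ([invariant_equation]), the jet of [f] lies in [E] if and only if [P] vanishes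
    at [diag l], and equivalently if and only if [P] vanishes at [diag (l o s)] for
    every permutation [s]. Over the reals these conditions together amount to the
    vanishing of the sum over [s] of the squares [P (diag (l o s)) ^ 2], which is a
    symmetric polynomial in [l]; by the fundamental theorem on symmetric polynomials
    and Newton's identities it is a polynomial [F] in the power sums of [l]
    ([diag_symmetrize_power_sums]). These power sums are the traces of the powers of
    the shape operator, which is similar to [W].

    The analytic part is the claim that the jet of [f] is a rotated jet
    [(0, 0, W)], which a priori calls for the implicit function theorem: a rotated
    graph has to be exhibited as a graph. It is avoided by choosing the
    representative. Among the hypersurfaces with 2-jet [(0, 0, W)] there is a quadric
    whose quadratic part vanishes on two directions, the old and the new direction
    of projection. It is of first degree along both, hence the graph of an explicit
    rational function ([osculant]) in both coordinate systems
    ([quadric_local_graph]). What remains is that rational functions are smooth, and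
    that Hessians are symmetric ([second_derivative_sym]), as is that of an
    [osculant]. *)

(** * Symmetric polynomials and power sums *)

Section PowerSums.
Import mpoly.
Variables (F : numFieldType) (n : nat).
Implicit Types l : 'I_n -> F.

Definition power_sum l k : F := \sum_i l i ^+ k.

(** The generating polynomial of the elementary symmetric functions of [l]. *)
Let E l : {poly F} := \prod_i (1 + l i *: 'X).

Lemma meval_mesym l k : meval l (mesym n F k) = (E l)`_k.
Proof.
rewrite /E (eq_bigr (fun i => l i *: 'X + 1)); last by move=> i _; rewrite addrC.
rewrite bigA_distr /mesym raddf_sum /= coef_sum [LHS]big_mkcond /=.
apply: eq_bigr => A _; rewrite -big_mkcond /= scaler_prod prodr_const coefZ coefXn.
rewrite eq_sym; case: eqP => _; last by rewrite mulr0.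
by rewrite rmorph_prod mulr1; apply: eq_bigr => i _; exact: mevalXU.
Qed.

(** Newton's identities in generating form: the logarithmic derivative of
    [1 + c X] is the geometric series [sum_j (-1)^j c^(j+1) X^j], and logarithmic
    derivatives of products add up. Working modulo [X^N], with the error term [r],
    keeps the series finite. *)
Lemma newton_mod l N : exists r,
  (E l)^`() =
  E l * (\sum_(j < N) ((-1) ^+ j * power_sum l j.+1) *: 'X^j) + 'X^N * r.
Proof.
rewrite /E /power_sum; elim: (index_enum _) => [|i s [r IH]].
  exists 0; rewrite big_nil -polyC1 derivC mulr0 addr0 mul1r big1 // => j _.
  by rewrite big_nil mulr0 scale0r.
(* Truncated geometric series of the factor that is being added. *)
set w : {poly F} := - (l i *: 'X).
have geo : (1 + l i *: 'X) * (\sum_(j < N) ((-1) ^+ j * l i ^+ j.+1) *: 'X^j)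
    = (l i)%:P - (l i)%:P * w ^+ N.
  have -> : \sum_(j < N) ((-1) ^+ j * l i ^+ j.+1) *: 'X^j
      = (l i)%:P * \sum_(j < N) w ^+ j.
    rewrite mulr_sumr; apply: eq_bigr => j _.
    rewrite /w -scaleNr exprZn -[- l i]mulN1r exprMn mul_polyC scalerA exprS.
    by rewrite mulrCA.
  rewrite mulrCA -{2}[(l i)%:P]mulr1 -mulrBr -(opprB _ 1) subrX1 -mulNr.
  by rewrite opprB /w opprK.
have [r' r'E] : exists r', (l i)%:P * w ^+ N = 'X^N * r'.
  exists ((l i)%:P * ((- l i) ^+ N)%:P); rewrite /w -scaleNr exprZn.
  by rewrite -mul_polyC [RHS]mulrC mulrA.
rewrite !big_cons derivM {}IH derivD -polyC1 derivC add0r derivZ derivX polyC1.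
exists (r' * \prod_(j <- s) (1 + l j *: 'X) + (1 + l i *: 'X) * r).
have -> : l i *: 1 = (1 + l i *: 'X) *
    (\sum_(j < N) ((-1) ^+ j * l i ^+ j.+1) *: 'X^j) + 'X^N * r'.
  by rewrite geo r'E subrK -mul_polyC mulr1.
under [X in _ = _ * X + _]eq_bigr => j _ do rewrite big_cons mulrDr scalerDl.
rewrite big_split /=.
by rewrite !mulrDr !mulrDl -!addrA; ring.
Qed.

Lemma newton l k : k.+1%:R * meval l (mesym n F k.+1) =
  \sum_(j < k.+1) (-1) ^+ j * power_sum l j.+1 * meval l (mesym n F (k - j)).
Proof.
have [r /(congr1 (fun p : {poly F} => p`_k))] := newton_mod l k.+1.
rewrite coef_deriv coefD coefXnM ltnS leqnn addr0 coefMr -meval_mesym.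
rewrite mulr_natl => ->; apply: eq_bigr => j _.
rewrite meval_mesym mulrC; congr (_ * _).
rewrite coef_sum (bigD1 j) //= big1 ?addr0 => [|i ij].
  by rewrite coefZ coefXn eqxx mulr1.
by rewrite coefZ coefXn -[_ == _]/(j == i) eq_sym (negPf ij) mulr0.
Qed.

(** Newton's identity expresses [k.+1] times an elementary symmetric function by
    earlier ones, so the recursion needs division by [k.+1]: this is where
    characteristic zero enters. *)
Lemma mesym_power_sums k : (k <= n)%N -> exists G : mpoly n F,
  forall l, meval l (mesym n F k) = meval (fun i => power_sum l i.+1) G.
Proof.
elim/ltn_ind: k => -[|k] IH kn.
  by exists 1 => l; rewrite mesym0E !meval1.
have /choice [G GE] (j : 'I_k.+1) : exists G : mpoly n F,
    forall l, meval l (mesym n F (k - j)) = meval (fun i => power_sum l i.+1) G.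
  by apply: IH; [rewrite ltnS leq_subr|rewrite (leq_trans (leq_subr _ _)) // ltnW].
exists (k.+1%:R^-1 *: \sum_(j < k.+1) (-1) ^+ j *: ('X_(widen_ord kn j) * G j)).
move=> l; rewrite mevalZ.
apply: (canRL (mulKf _)); first by rewrite pnatr_eq0.
rewrite [LHS]newton [RHS]raddf_sum; apply: eq_bigr => j _.
by rewrite [RHS]mevalZ mevalM mevalXU GE mulrA.
Qed.

Theorem symmetric_power_sums (p : mpoly n F) : p \is symmetric ->
  exists G : mpoly n F,
    forall l, meval l p = meval (fun i => power_sum l i.+1) G.
Proof.
move=> /sym_fundamental[t [<- _]].
have /choice [G GE] (i : 'I_n) := mesym_power_sums (ltn_ord i).
exists (t \mPo [tuple G i | i < n]) => l; rewrite !comp_mpoly_meval.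
by apply: meval_eq => i; rewrite !tnth_mktuple GE.
Qed.

End PowerSums.

Section Symmetrize.
Import mpoly.
Variables (F : realFieldType) (n : nat).

Lemma meval_msym (l : 'I_n -> F) (s : 'S_n) (p : mpoly n F) :
  meval l (msym s p) = meval (l \o s) p.
Proof.
rewrite [RHS]mevalE /msym /mmap [LHS]raddf_sum; apply: eq_bigr => m _.
rewrite [LHS]mevalM mevalC /mmap1 rmorph_prod; congr (_ * _).
by apply: eq_bigr => i _; rewrite [LHS]rmorphXn [X in X ^+ _]mevalXU.
Qed.

(** A real sum of squares vanishes exactly when every term does. The points
    all of whose permutations are zeros of [p] are thus cut out by one symmetric
    polynomial, the sum of the squares of the permuted copies of [p]. *)
Lemma symmetrize_power_sums (p : mpoly n F) : exists G : mpoly n F,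
  forall l, (forall s : 'S_n, meval (l \o s) p = 0) <->
            meval (fun i => power_sum l i.+1) G = 0.
Proof.
have sq_sym : \sum_(s : 'S_n) msym s p ^+ 2 \is symmetric.
  apply/issymP => t; rewrite raddf_sum [RHS](reindex_inj (mulIg t)).
  by apply: eq_bigr => s _; rewrite [LHS]rmorphXn [X in X ^+ _]/= msymMm.
have [G GE] := symmetric_power_sums sq_sym; exists G => l; rewrite -GE.
have -> : meval l (\sum_s msym s p ^+ 2) = \sum_(s : 'S_n) meval (l \o s) p ^+ 2.
  rewrite raddf_sum; apply: eq_bigr => s _.
  by rewrite [LHS]rmorphXn [X in X ^+ _]meval_msym.
split=> [h|/eqP].
  by rewrite big1 // => s _; rewrite h expr0n.
rewrite psumr_eq0 => [/allP h s|s _]; last exact: sqr_ge0.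
by apply/eqP; have := h s; rewrite mem_index_enum sqrf_eq0; apply.
Qed.

(** The previous lemma for the restriction to diagonal matrices of a polynomial in
    the entries of a matrix. *)
Lemma diag_symmetrize_power_sums (P : mpoly (n * n) F) :
  exists G : mpoly n F, forall l : 'rV[F]_n,
    (forall s : 'S_n,
       meval (mxvec (diag_mx (\row_i l 0 (s i))) 0) P = 0) <->
    meval (fun k : 'I_n => \sum_i l 0 i ^+ k.+1) G = 0.
Proof.
(* The generic diagonal matrix; substituting its entries in [P] restricts [P]. *)
pose X : 'M[{mpoly F[n]}]_n := diag_mx (\row_i 'X_i).
have [G GE] :=
  symmetrize_power_sums (P \mPo [tuple mxvec X 0 k | k < n * n]).
exists G => l; rewrite -(GE (l 0)).
have evalE (s : 'S_n) :
    meval (l 0 \o s) (P \mPo [tuple mxvec X 0 k | k < n * n]) =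
    meval (mxvec (diag_mx (\row_i l 0 (s i))) 0) P.
  rewrite comp_mpoly_meval; apply: meval_eq => k; rewrite tnth_mktuple.
  case/mxvec_indexP: k => i j; rewrite !mxvecE !mxE.
  by rewrite raddfMn /= mevalXU.
by split=> h s; [rewrite evalE|rewrite -evalE].
Qed.

End Symmetrize.

(** * The spectral theorem for real symmetric matrices *)

Section Spectral.
Import complex.
Variable R : rcfType.

Lemma sqnorm_gt0 n (v : 'rV[R]_n) : v != 0 -> 0 < (v *m v^T) 0 0.
Proof.
move=> v0; rewrite mxE lt_neqAle sumr_ge0 => [|i _]; last first.
  by rewrite mxE -expr2 sqr_ge0.
rewrite andbT eq_sym psumr_eq0 => [|i _]; last by rewrite mxE -expr2 sqr_ge0.
apply: contra v0 => /allP h; apply/eqP/rowP => i; rewrite mxE.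
by have := h i; rewrite mem_index_enum mxE -expr2 sqrf_eq0 => /(_ isT)/eqP.
Qed.

(** Over the complexification [A] is hermitian, hence unitarily diagonalisable with
    real eigenvalues, and being an eigenvalue does not depend on the field. *)
Lemma symmetric_eigenvalue n (A : 'M[R]_n.+1) : A^T = A ->
  exists a, eigenvalue A a.
Proof.
move=> As; pose C := R[i]%C; pose f : {rmorphism R -> C} := real_complex R.
have hA : map_mx f A \is hermsymmx.
  apply: realsym_hermsym.
    by apply/is_hermitianmxP; rewrite scale1r map_mx_id // map_trmx As.
  by apply/mxOverP => i j; rewrite mxE; apply/complex_realP; exists (A i j).
have /orthomx_spectralP := hermitian_normalmx hA.
set P := spectralmx _; set sp := spectral_diag _ => AE.
have Pu : P \in unitmx := spectral_unit _.
have := hermitian_spectral_diag_real hA => /mxOverP/(_ 0 0).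
move=> /complex_realP[a aE]; exists a; rewrite -(eigenvalue_map f).
apply/eigenvalueP; exists (row 0 P).
  rewrite AE !mulmxA -row_mul mulmxV // row1 -rowE row_diag_mx.
  by rewrite -scalemxAl -rowE aE.
apply/eqP => /(congr1 (fun r => (r *m invmx P) 0 0)).
rewrite -row_mul mulmxV // mul0mx !mxE eqxx => /eqP.
by rewrite oner_eq0.
Qed.

Lemma reflection_orthogonal n (w : 'rV[R]_n) s : w *m w^T = s%:M -> s != 0 ->
  let Q := 1%:M - (2 / s) *: (w^T *m w) in Q *m Q^T = 1%:M.
Proof.
move=> ww s0 Q; have -> : Q^T = Q.
  by rewrite /Q linearB /= trmx1 linearZ /= trmx_mul trmxK.
rewrite /Q mulmxBl mul1mx mulmxBr mulmx1 -!scalemxAl -!scalemxAr !mulmxA.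
rewrite -(mulmxA w^T w) ww mul_mx_scalar -scalemxAl !scalerA -!addrA.
rewrite -opprD -scalerBl -scalerDl.
have -> : 2 / s + (2 / s - 2 / s * (2 / s * s)) = 0 by field.
by rewrite scale0r subr0.
Qed.

(** The first row of the Householder reflection that exchanges [u] and the first
    basis vector is [u]; it replaces Gram-Schmidt orthonormalisation. *)
Lemma orthogonal_row n (u : 'rV[R]_n.+1) : u *m u^T = 1%:M ->
  exists2 Q : 'M[R]_n.+1, Q *m Q^T = 1%:M & row 0 Q = u.
Proof.
move=> u1; pose e : 'rV[R]_n.+1 := delta_mx 0 0.
have [<-|ue] := eqVneq e u.
  by exists 1%:M; rewrite ?trmx1 ?mulmx1 // row1.
pose w := u - e; have w0 : w != 0 by rewrite subr_eq0 eq_sym.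
have := sqnorm_gt0 w0; set s := _ 0 0 => s0.
have wwE : w *m w^T = s%:M by rewrite [LHS]mx11_scalar.
have eeE : e *m e^T = 1%:M.
  rewrite trmx_delta mul_delta_mx.
  by apply/matrixP=> i j; rewrite !mxE !ord1.
pose c := (e *m u^T) 0 0.
have euE : e *m u^T = c%:M by rewrite [LHS]mx11_scalar.
have ueE : u *m e^T = c%:M.
  by rewrite -[LHS]trmxK trmx_mul trmxK euE tr_scalar_mx.
have ewE : e *m w^T = (c - 1)%:M by rewrite linearB mulmxBr euE eeE -raddfB.
have sE : s = 2 - 2 * c.
  have := wwE; rewrite /w linearB mulmxBr !mulmxBl u1 euE ueE eeE -!raddfB.
  by move=> /(congr1 (fun M : 'M_1 => M 0 0)); rewrite !mxE !mulr1n => <-; ring.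
exists (1%:M - (2 / s) *: (w^T *m w)).
  by apply: reflection_orthogonal => //; rewrite gt_eqF.
rewrite rowE (mulmxBr e) mulmx1 -scalemxAr mulmxA ewE mul_scalar_mx scalerA.
have -> : 2 / s * (c - 1) = - 1.
  have -> : c - 1 = - (s / 2) by rewrite sE; field.
  by field; rewrite gt_eqF.
by rewrite scaleN1r opprK /w addrCA subrr addr0.
Qed.

Lemma block1_orthogonal n (B : 'M[R]_n) : B *m B^T = 1%:M ->
  (block_mx 1%:M 0 0 B : 'M_(1 + n)) *m (block_mx 1%:M 0 0 B)^T = 1%:M.
Proof.
move=> BB; rewrite tr_block_mx mulmx_block !trmx0 trmx1 BB.
by rewrite !mulmx0 !mul0mx mulmx1 !addr0 add0r -scalar_mx_block.
Qed.

(** Split off a unit eigenvector: in an orthonormal frame that starts with it, the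
    first row of [A] vanishes off the diagonal, by symmetry so does the first
    column, and the remaining block is again symmetric. *)
Theorem symmetric_spectral n (A : 'M[R]_n) : A^T = A ->
  exists (B : 'M[R]_n) (l : 'rV[R]_n),
    B *m B^T = 1%:M /\ A = B *m diag_mx l *m B^T.
Proof.
elim: n A => [|n IH] A As.
  by exists 1%:M, 0; split; apply/matrixP=> -[].
have [a /eigenvalueP[v vA v0]] := symmetric_eigenvalue As.
have := sqnorm_gt0 v0; set s := _ 0 0 => s0.
pose u := (Num.sqrt s)^-1 *: v.
have uu : u *m u^T = 1%:M.
  rewrite /u linearZ /= -scalemxAl -scalemxAr scalerA.
  rewrite [X in _ *: X]mx11_scalar -/s scale_scalar_mx.
  by rewrite -expr2 exprVn sqr_sqrtr ?ltW // mulVf // gt_eqF.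
have uA : u *m A = a *: u by rewrite /u -scalemxAl vA !scalerA mulrC.
have [Q QQ Qu] := orthogonal_row uu.
have QQ' := mulmx1C QQ.
pose A1 : 'M_(1 + n) := Q *m A *m Q^T.
have A1s : A1^T = A1 by rewrite /A1 !trmx_mul trmxK As mulmxA.
have A1r j : A1 0 j = a * (0 == j)%:R.
  have : row 0 A1 = a *: row 0 (1%:M).
    by rewrite /A1 !row_mul Qu uA -scalemxAl -Qu -row_mul QQ.
  by move=> /rowP/(_ j); rewrite !mxE.
have AE : A = Q^T *m A1 *m Q.
  by rewrite /A1 !mulmxA QQ' mul1mx -mulmxA QQ' mulmx1.
clearbody A1.
have ls0 : lshift n (0 : 'I_1) = 0 by exact: val_inj.
have A1b : A1 = block_mx a%:M 0 0 (drsubmx A1).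
  have ur : ursubmx A1 = 0.
    apply/matrixP => i j; rewrite ord1 !mxE ls0 A1r.
    by rewrite -val_eqE /= mulr0.
  rewrite -[LHS]submxK ur -[dlsubmx A1]trmxK trmx_dlsub A1s ur trmx0.
  congr block_mx; apply/matrixP => i j; rewrite !ord1 !mxE ls0 A1r.
  by rewrite eqxx mulr1.
have /IH[B [l [BB Bl]]] : (drsubmx A1)^T = drsubmx A1.
  by rewrite trmx_drsub A1s.
pose B1 : 'M_(1 + n) := block_mx 1%:M 0 0 B.
have B1B1 : B1 *m B1^T = 1%:M by exact: block1_orthogonal.
exists (Q^T *m B1), (row_mx a%:M l : 'rV_(1 + n)); split.
  by rewrite trmx_mul trmxK -mulmxA (mulmxA B1) B1B1 mul1mx.
rewrite AE trmx_mul trmxK !mulmxA; congr (_ *m _).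
rewrite -!mulmxA; congr (_ *m _).
have dE : diag_mx (row_mx a%:M l : 'rV_(1 + n)) =
    block_mx a%:M 0 0 (diag_mx l) :> 'M_(1 + n).
  rewrite diag_mx_row; congr block_mx.
  by apply/matrixP => i j; rewrite !ord1 !mxE.
have : B1 *m (block_mx a%:M 0 0 (diag_mx l) *m B1^T) =
    block_mx a%:M 0 0 (B *m diag_mx l *m B^T) :> 'M_(1 + n).
  rewrite /B1 tr_block_mx !mulmx_block !trmx0 trmx1.
  by rewrite !mulmx0 !mul0mx !mul1mx !mulmx1 !addr0 !add0r mulmxA !mulmx0.
by rewrite A1b Bl => <-; rewrite -dE.
Qed.

End Spectral.

(** * Smooth functions *)

From Stdlib Require Import Relation_Operators.
From mathcomp Require Import generic_quotient functions topology normedtype.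
From mathcomp Require Import landau derive.
Import numFieldNormedType.Exports Defs.

Local Open Scope classical_set_scope.
Local Open Scope quotient_scope.
Local Open Scope ring_scope.

Section Smooth.
Variables (R : realType) (V : normedModType R).
Implicit Types (U : set V) (f g : V -> R).

(** [Ck] asks for derivatives of globally defined functions, whereas formulas such
    as the one for the derivative of an inverse hold only on an open set; hence
    locality of differentiability, and then of [Ck]. *)
Lemma differentiable_near f g x :
  (\near x, f x = g x) -> differentiable f x -> differentiable g x.
Proof.
move=> fg df; have gx : g x = f x by rewrite (nbhs_singleton fg).
have dg : g \o shift x = cst (g x) + 'd f x +o_ 0 id.
  apply/eqaddoP => e e0.
  have /eqaddoP/(_ _ e0) fo := diff_locally df.
  have fg0 : \forall h \near (0 : V), f (h + x) = g (h + x).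
    by move: fg; rewrite (near_shift 0) subr0.
  by apply: filterS2 fo fg0 => h; rewrite /= !fctE /= => + <-; rewrite gx.
apply/diff_locallyP; have dfc := diff_continuous df.
by rewrite (diff_unique dfc dg).
Qed.

Lemma CkW k U f : Ck k.+1 U f -> Ck k U f.
Proof.
elim: k f => [|k IH] f [df Df]; first by move=> x /df/differentiable_continuous.
by split=> // v; apply: IH; exact: Df.
Qed.

Lemma eq_Ck k U f g : open U -> (forall x, U x -> f x = g x) ->
  Ck k U f -> Ck k U g.
Proof.
move=> oU; elim: k f g => [|k IH] f g fg.
  move=> cf x Ux; have fgx : \near x, f x = g x.
    by apply: filterS (open_nbhs_nbhs (conj oU Ux)).
  rewrite /prop_for /continuous_at -(fg _ Ux); apply: cvg_trans (cf x Ux).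
  by apply: near_eq_cvg; apply: filterS fgx => y.
have fgn x : U x -> \near x, f x = g x.
  by move=> Ux; apply: filterS (open_nbhs_nbhs (conj oU Ux)).
move=> [df Df]; split=> [x Ux|v].
  exact: differentiable_near (fgn x Ux) (df x Ux).
by apply: IH (Df v) => x /fgn; exact: near_eq_derive.
Qed.

Lemma Ck_cst k U (a : R) : Ck k U (fun=> a).
Proof.
elim: k a => [|k IH] a; first by move=> x _; exact: cvg_cst.
split=> [x _|v]; first exact: differentiable_cst.
by under eq_fun do rewrite derive_cst; exact: IH.
Qed.

Lemma CkD k U f g : open U -> Ck k U f -> Ck k U g -> Ck k U (f + g).
Proof.
move=> oU; elim: k f g => [|k IH] f g.
  by move=> cf cg x Ux; apply: continuousD; [exact: cf|exact: cg].
move=> [df Df] [dg Dg]; split=> [x Ux|v].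
  by apply: differentiableD; [exact: df|exact: dg].
apply: eq_Ck (IH _ _ (Df v) (Dg v)) => // x Ux.
by rewrite deriveD //; apply: diff_derivable; [exact: df|exact: dg].
Qed.

Lemma CkM k U f g : open U -> Ck k U f -> Ck k U g -> Ck k U (f * g).
Proof.
move=> oU; elim: k f g => [|k IH] f g.
  by move=> cf cg x Ux; apply: continuousM; [exact: cf|exact: cg].
move=> cf cg; have [df Df] := cf; have [dg Dg] := cg; split=> [x Ux|v].
  by apply: differentiableM; [exact: df|exact: dg].
apply: eq_Ck (CkD oU (IH _ _ (CkW cf) (Dg v)) (IH _ _ (CkW cg) (Df v))) => //.
move=> x Ux.
by rewrite deriveM //; apply: diff_derivable; [exact: df|exact: dg].
Qed.

Lemma CkV k U f : open U -> (forall x, U x -> f x != 0) ->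
  Ck k U f -> Ck k U (fun x => (f x)^-1).
Proof.
move=> oU f0; elim: k => [|k IH] cf.
  by move=> x Ux; apply: continuousV; [exact: f0|exact: cf].
have [df Df] := cf; have fV := IH (CkW cf); split=> [x Ux|v].
  by apply: differentiableV; [exact: df|exact: f0].
have cD := CkM oU (Ck_cst k U (-1)) (CkM oU (CkM oU fV fV) (Df v)).
apply: eq_Ck cD => // x Ux.
rewrite deriveV ?f0 //; last by apply: diff_derivable; exact: df.
by rewrite !fctE expr2 invfM mulN1r -mulNr.
Qed.

Lemma Ck_sum k U (I : Type) (s : seq I) (F : I -> V -> R) : open U ->
  (forall i, Ck k U (F i)) -> Ck k U (fun x => \sum_(i <- s) F i x).
Proof.
move=> oU cF; elim: s => [|i s IH].
  by under eq_fun do rewrite big_nil; exact: Ck_cst.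
by under eq_fun do rewrite big_cons; exact: CkD.
Qed.

End Smooth.

(** * Symmetry of second derivatives *)

Lemma dist_half (R : realFieldType) (p q z e : R) :
  `|p - z| < e / 2 -> `|q - z| < e / 2 -> `|p - q| <= e.
Proof.
move=> pz qz; apply: le_trans (ler_distD z _ _) _; rewrite [leRHS]splitr.
by rewrite (distrC z); apply: lerD; apply: ltW.
Qed.

Section Schwarz.
Variables (R : realType) (V : normedModType R).
Implicit Types (U : set V) (f : V -> R).

Lemma is_derive_line f (a u : V) (s : R) : differentiable f (a + s *: u) ->
  is_derive s 1 (fun t : R => f (a + t *: u)) ('D_u f (a + s *: u)).
Proof.
move=> df.
have dl : is_diff s (fun t : R => a + t *: u) (fun t => t *: u).
  have := is_diffD (is_diff_cst a s) (is_diff_scalel s u).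
  by rewrite add0r.
have dl' : differentiable (fun t : R => a + t *: u) s by case: dl.
have dc : differentiable (f \o (fun t : R => a + t *: u)) s.
  exact: differentiable_comp.
split; first by apply: diff_derivable.
rewrite (deriveE _ dc) diff_comp //.
by case: dl => _ dlE; rewrite /= dlE scale1r deriveE.
Qed.

Lemma MVT_closed (F dF : R -> R) (h : R) : 0 < h ->
  (forall s, s \in `[0, h] -> is_derive s 1 F (dF s)) ->
  exists2 c, c \in `]0, h[ & F h - F 0 = h * dF c.
Proof.
move=> h0 FdF.
have dF_oo s : s \in `]0, h[ -> is_derive s 1 F (dF s).
  by move=> /subset_itv_oo_cc; exact: FdF.
have cF : {within `[0, h], continuous F}.
  apply: continuous_in_subspaceT => s /set_mem sh; apply: differentiable_continuous.
  by apply/derivable1_diffP; have [] := FdF s sh.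
have [c ch cE] := @MVT R F dF 0 h h0 dF_oo cF.
by exists c => //; rewrite cE subr0 mulrC.
Qed.

(** Two applications of the mean value theorem, first along [u], then along [v].
    The second difference on the left is symmetric in [u] and [v]. *)
Lemma second_difference f (x u v : V) (h : R) : 0 < h ->
  (forall s t : R, s \in `[0, h] -> t \in `[0, h] ->
     differentiable f (x + s *: u + t *: v) /\
     differentiable (fun y => 'D_u f y) (x + s *: u + t *: v)) ->
  exists c d, [/\ c \in `]0, h[, d \in `]0, h[ &
    f (x + h *: u + h *: v) - f (x + h *: v) - (f (x + h *: u) - f x) =
      h * (h * 'D_v (fun y => 'D_u f y) (x + c *: u + d *: v))].
Proof.
move=> h0 df; have h0h : 0 \in `[0, h] by rewrite in_itv /= lexx ltW.
have hhh : h \in `[0, h] by rewrite in_itv /= lexx ltW.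
have dg (s : R) : s \in `[0, h] ->
    is_derive s 1 (fun s : R => f (x + h *: v + s *: u) - f (x + s *: u))
      ('D_u f (x + h *: v + s *: u) - 'D_u f (x + s *: u)).
  move=> sh; apply: is_deriveB; apply: is_derive_line.
    by rewrite addrAC; have [] := df s h sh hhh.
  by have [] := df s 0 sh h0h; rewrite scale0r addr0.
have [c ch cE] := MVT_closed h0 dg.
have ch' := subset_itv_oo_cc ch.
have [d dh dE] := MVT_closed h0 (fun t th => is_derive_line (df c t ch' th).2).
exists c, d; split => //; rewrite -dE scale0r addr0.
rewrite (addrAC x (c *: u)) -cE scale0r !addr0 (addrAC x (h *: v)); ring.
Qed.

(** Schwarz's theorem. By [second_difference], each iterated derivative takes,
    at some point near [x], the same value as the other one does at another point
    near [x]; both are continuous at [x]. *)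
Lemma second_derivative_sym f (x u v : V) (U : set V) : nbhs x U ->
  (forall y, U y -> differentiable f y) ->
  (forall y, U y -> differentiable (fun y => 'D_u f y) y) ->
  (forall y, U y -> differentiable (fun y => 'D_v f y) y) ->
  {for x, continuous (fun y => 'D_v (fun y => 'D_u f y) y)} ->
  {for x, continuous (fun y => 'D_u (fun y => 'D_v f y) y)} ->
  'D_v (fun y => 'D_u f y) x = 'D_u (fun y => 'D_v f y) x.
Proof.
move=> Ux df duf dvf cvu cuv.
apply/eqP; rewrite -subr_eq0 -normr_le0; apply/ler_addgt0Pr => e e0.
rewrite add0r; have e20 : 0 < e / 2 by rewrite divr_gt0.
have /nbhs_normP[r r0 rW] : \near x, U x by exact: Ux.
have /cvgrPdist_lt/(_ _ e20)/nbhs_normP[r1 r10 r1W] := cvu.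
have /cvgrPdist_lt/(_ _ e20)/nbhs_normP[r2 r20 r2W] := cuv.
pose r3 := Num.min r (Num.min r1 r2).
have r30 : 0 < r3 by rewrite !lt_min r0 r10.
have N0 : 0 < `|u| + `|v| + 1 by rewrite ltr_wpDl // addr_ge0.
(* With this step the parallelogram with sides [h u] and [h v] at [x] stays in
   the ball of radius [r3]. *)
pose h := r3 / (`|u| + `|v| + 1).
have h0 : 0 < h by rewrite divr_gt0.
have near_x s t : s \in `[0, h] -> t \in `[0, h] ->
    `|x - (x + s *: u + t *: v)| < r3.
  rewrite !in_itv /= => /andP[s0 sh] /andP[t0 th].
  rewrite -addrA opprD addNKr normrN.
  apply: le_lt_trans (ler_normD _ _) _; rewrite !normrZ !ger0_norm //.
  have : s * `|u| + t * `|v| <= h * (`|u| + `|v|).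
    by rewrite mulrDr lerD // ler_wpM2r.
  move=> /le_lt_trans; apply.
  rewrite -[X in _ < X](divfK (lt0r_neq0 N0)) -/h.
  by rewrite ltr_pM2l // ltrDl.
have lt3 y : `|x - y| < r3 -> [/\ `|x - y| < r, `|x - y| < r1 & `|x - y| < r2].
  by rewrite !lt_min => /and3P[].
have nW s t : s \in `[0, h] -> t \in `[0, h] -> U (x + s *: u + t *: v).
  by move=> sh th; apply: rW => /=; have [] := lt3 _ (near_x s t sh th).
have [s t sh th|c [d [ch dh cdE]]] := @second_difference f x u v h h0.
  by split; [apply: df|apply: duf]; exact: nW.
have [s t sh th|c' [d' [ch' dh' cdE']]] := @second_difference f x v u h h0.
  by rewrite addrAC; split; [apply: df|apply: dvf]; exact: nW.
have : h * (h * 'D_v (fun y => 'D_u f y) (x + c *: u + d *: v)) =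
       h * (h * 'D_u (fun y => 'D_v f y) (x + c' *: v + d' *: u)).
  rewrite -[LHS]cdE -[RHS]cdE' (addrAC x (h *: v)).
  have swap (k l m o : R) : k - l - (m - o) = k - m - (l - o) by ring.
  exact: swap.
move=> /(mulfI (lt0r_neq0 h0)) /(mulfI (lt0r_neq0 h0)) DE.
have [_ n1 _] := lt3 _ (near_x _ _ (subset_itv_oo_cc ch) (subset_itv_oo_cc dh)).
have [_ _ n2] := lt3 _ (near_x _ _ (subset_itv_oo_cc dh') (subset_itv_oo_cc ch')).
have /= b1 := r1W _ n1; have /= b2 := r2W _ n2.
rewrite DE (addrAC x) in b1.
exact: dist_half b1 b2.
Qed.

End Schwarz.

(** * Rational functions with a prescribed 2-jet *)

Section Osculant.
Variables (R : realType) (n : nat).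
Implicit Types (x y v p m : 'cV[R]_n) (q : 'rV[R]_n) (H : 'M[R]_n) (u : R).

Definition lin q x y : R := (q *m (y - x)) 0 0.
Definition quad H x y : R := ((y - x)^T *m H *m (y - x)) 0 0.
Definition den m x y : R := 1 + lin m^T x y.
(** A function with the 2-jet [(u, p, H)] at [x] whose graph is a quadric. The
    denominator does not affect the 2-jet; the vector [m] is a free parameter that
    is adjusted to make the graph of one such function the rotated graph of
    another. *)
Definition osculant x u p H m y : R :=
  u + lin p^T x y + quad H x y / 2 / den m x y.

Lemma lin_center q x : lin q x x = 0.
Proof. by rewrite /lin subrr mulmx0 mxE. Qed.

Lemma quad_center H x : quad H x x = 0.
Proof. by rewrite /quad subrr mulmx0 mxE. Qed.

Lemma den_center m x : den m x x = 1.
Proof. by rewrite /den lin_center addr0. Qed.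

Lemma osculant_center x u p H m : osculant x u p H m x = u.
Proof. by rewrite /osculant lin_center quad_center !mul0r !addr0. Qed.

Lemma quadE H x y :
  quad H x y = \sum_i lin (delta_mx 0 i) x y * lin (row i H) x y.
Proof.
rewrite /quad -mulmxA mxE; apply: eq_bigr => i _.
by rewrite /lin -rowE -row_mul !mxE.
Qed.

Lemma is_diff_coord (i : 'I_n) y :
  is_diff y (fun z : 'cV[R]_n => z i 0) (fun v => v i 0).
Proof.
have @f : {linear 'cV[R]_n -> R}.
  by exists (fun z : 'cV[R]_n => z i 0); do 2![eexists]; do ?[constructor];
     rewrite ?mxE// => ? *; rewrite ?mxE//; move=> ?; rewrite !mxE.
have fc : continuous f by exact: coord_continuous.
rewrite (_ : (fun _ => _) = f) //.
split; [exact: linear_differentiable|exact: diff_lin].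
Qed.

Lemma is_derive_coord (i : 'I_n) y v :
  is_derive y v (fun z : 'cV[R]_n => z i 0) (v i 0).
Proof.
have [df dE] := is_diff_coord i y.
by split; [exact: diff_derivable|rewrite deriveE // dE].
Qed.

Lemma linE q x :
  lin q x = \sum_j (q 0 j *: ((fun z : 'cV[R]_n => z j 0) - cst (x j 0))).
Proof.
apply/funext => z; rewrite /lin mxE fct_sumE; apply: eq_bigr => j _.
by rewrite !mxE.
Qed.

Lemma is_derive_lin q x y v : is_derive y v (lin q x) ((q *m v) 0 0).
Proof.
rewrite linE (_ : (q *m v) 0 0 = \sum_j q 0 j *: (v j 0 - 0)); last first.
  by rewrite mxE; apply: eq_bigr => j _; rewrite subr0.
apply: is_derive_sum => j; apply: is_deriveZ; apply: is_deriveB.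
exact: is_derive_coord.
Qed.

Lemma differentiable_lin q x y : differentiable (lin q x) y.
Proof.
rewrite linE; apply: differentiable_sum => j; apply: differentiableZ.
apply: differentiableB; last exact: differentiable_cst.
by have [] := is_diff_coord j y.
Qed.

Lemma Ck_lin k U q x : Ck k U (lin q x).
Proof.
case: k => [|k].
  by move=> y _; exact/differentiable_continuous/differentiable_lin.
split=> [y _|v]; first exact: differentiable_lin.
rewrite (_ : (fun y => _) = fun=> (q *m v) 0 0); first exact: Ck_cst.
by apply/funext => y; have [] := is_derive_lin q x y v.
Qed.

Lemma Ck_den k U m x : open U -> Ck k U (den m x).
Proof. by move=> oU; apply: CkD => //; [exact: Ck_cst|exact: Ck_lin]. Qed.

Lemma den_open m x : open [set y | den m x y != 0].
Proof.
apply: (@open_comp _ _ (den m x) [set r | r != 0]); last exact: open_neq.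
by move=> y _; exact: (@Ck_den 0 setT m x openT y I).
Qed.

Lemma Ck_quad k U H x : open U -> Ck k U (quad H x).
Proof.
move=> oU; rewrite (funext (quadE H x)); apply: Ck_sum => // i.
by apply: CkM => //; exact: Ck_lin.
Qed.

Lemma osculant_smooth x u p H m :
  smooth_on [set y | den m x y != 0] (osculant x u p H m).
Proof.
have oU := @den_open m x; move=> k; apply: CkD => //.
  by apply: CkD => //; [exact: Ck_cst|exact: Ck_lin].
apply: CkM => //; first by apply: CkM => //; [exact: Ck_quad|exact: Ck_cst].
by apply: CkV => //; exact: Ck_den.
Qed.

Definition osculant_fun x u p H m : lfun R n :=
  LFun (@den_open m x) (@osculant_smooth x u p H m).

Lemma osculant_dom x u p H m : dom (osculant_fun x u p H m) x.
Proof. by rewrite /= den_center oner_eq0. Qed.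

Lemma is_derive_quad H x y v : H^T = H ->
  is_derive y v (quad H x) (2 * lin (v^T *m H) x y).
Proof.
move=> Hs.
have -> : quad H x = \sum_(i < n) (lin (delta_mx 0 i) x * lin (row i H) x).
  by apply/funext => z; rewrite quadE fct_sumE.
have -> : 2 * lin (v^T *m H) x y = \sum_(i < n)
    (lin (delta_mx 0 i) x y *: (row i H *m v) 0 0 +
     lin (row i H) x y *: ((delta_mx 0 i : 'rV_n) *m v) 0 0).
  rewrite mulr_natl mulr2n big_split; congr (_ + _).
    have -> : lin (v^T *m H) x y = (v^T *m H *m (y - x))^T 0 0 by rewrite mxE.
    rewrite !trmx_mul trmxK Hs mxE; apply: eq_bigr => i _.
    by rewrite /lin -rowE -row_mul !mxE.
  rewrite /lin -mulmxA mxE; apply: eq_bigr => i _.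
  by rewrite -rowE -row_mul !mxE [RHS]mulrC.
by apply: is_derive_sum => i; apply: is_deriveM; exact: is_derive_lin.
Qed.

Lemma is_derive_den m x y v : is_derive y v (den m x) ((m^T *m v) 0 0).
Proof.
rewrite -[X in is_derive _ _ _ X]add0r; apply: is_deriveD.
exact: is_derive_lin.
Qed.

Lemma is_derive_den_inv m x y v : den m x y != 0 ->
  is_derive y v (fun z => (den m x z)^-1) (- (den m x y) ^- 2 *: (m^T *m v) 0 0).
Proof.
move=> d0; have [dd dE] := is_derive_den m x y v.
by split; [exact: derivableV|rewrite deriveV // dE].
Qed.

(** The directional derivative of [osculant x u p H m] along [v], in product form,
    so that it can be differentiated once more term by term. *)
Definition osculant_derive x p H m v : 'cV[R]_n -> R := cst ((p^T *m v) 0 0) +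
  (lin (v^T *m H) x * (fun y => (den m x y)^-1) -
   2^-1 *: (quad H x * ((m^T *m v) 0 0 *:
     ((fun y => (den m x y)^-1) * (fun y => (den m x y)^-1))))).

Lemma is_derive_osculant x u p H m y v : H^T = H -> den m x y != 0 ->
  is_derive y v (osculant x u p H m) (osculant_derive x p H m v y).
Proof.
move=> Hs d0; have dl := is_derive_lin p^T x y v.
have dq := is_derive_quad x y v Hs; have dd := is_derive_den_inv v d0.
have := is_deriveD (is_deriveD (is_derive_cst u y v) dl)
  (is_deriveZ 2^-1 (is_deriveM dq dd)).
have -> : cst u + lin p^T x + 2^-1 *: (quad H x * (fun z => (den m x z)^-1)) =
    osculant x u p H m.
  by apply/funext => z; rewrite /osculant !fctE [_ / 2]mulrC -mulrA.
move=> h; apply: is_derive_eq.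
rewrite /osculant_derive !fctE add0r /GRing.scale /= expr2 invfM; field.
by [].
Qed.

(** At the centre [quad H x] vanishes to second order, so only the derivative of
    [lin (v^T *m H) x] survives. *)
Lemma is_derive_osculant_derive x p H m v w : H^T = H ->
  is_derive x w (osculant_derive x p H m v) ((v^T *m H *m w) 0 0).
Proof.
move=> Hs; have d0 : den m x x != 0 by rewrite den_center oner_eq0.
have dl := is_derive_lin (v^T *m H) x x w.
have dq := is_derive_quad x x w Hs; have dd := is_derive_den_inv w d0.
have := is_deriveD (is_derive_cst ((p^T *m v) 0 0) x w)
  (is_deriveB (is_deriveM dl dd)
    (is_deriveZ 2^-1 (is_deriveM dq
      (is_deriveZ ((m^T *m v) 0 0) (is_deriveM dd dd))))).
move=> h; apply: is_derive_eq.
rewrite !fctE !lin_center quad_center den_center.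
by rewrite /GRing.scale /= invr1; ring.
Qed.

Lemma coords_osculant x u p H m : H^T = H ->
  coords (osculant_fun x u p H m) x = (col_mx u%:M x, p, H).
Proof.
move=> Hs; have d0 : den m x x != 0 by rewrite den_center oner_eq0.
have pE i y : den m x y != 0 ->
    partial i (osculant x u p H m) y = osculant_derive x p H m (delta_mx i 0) y.
  by move=> yd; have [] := is_derive_osculant u p (delta_mx i 0) Hs yd.
congr (_, _, _).
- by rewrite /gpoint /= osculant_center.
- apply/colP => i; rewrite mxE pE // /osculant_derive !fctE lin_center quad_center.
  by rewrite !mul0r scaler0 subrr addr0 -colE !mxE.
apply/matrixP => i j; rewrite mxE /partial.
have [_ DE] := is_derive_osculant_derive x p m (delta_mx j 0) (delta_mx i 0) Hs.
transitivity ('D_(delta_mx i 0) (osculant_derive x p H m (delta_mx j 0)) x).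
  apply: near_eq_derive.
  apply: filterS (open_nbhs_nbhs (conj (@den_open m x) d0)).
  by move=> y; exact: pE.
by rewrite DE trmx_delta -rowE -colE !mxE -[in LHS]Hs mxE.
Qed.

End Osculant.

(** * Motions acting on jets *)

Section Geometry.
Variables (R : realType) (n : nat).
Implicit Types (E : set (J2 R n)) (phi : motion R n).

Lemma hessian_sym (f : lfun R n) x : dom f x -> (coords f x).2^T = (coords f x).2.
Proof.
move=> fx; have Ux : nbhs x (dom f).
  by apply: open_nbhs_nbhs; split=> //; exact: dom_open.
have [df Df] := fn_smooth f 2.
apply/matrixP => i j; rewrite !mxE.
apply: second_derivative_sym Ux df _ _ _ _.
- by have [] := Df (delta_mx i 0).
- by have [] := Df (delta_mx j 0).
- by have [_ /(_ (delta_mx j 0))] := Df (delta_mx i 0); apply.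
- by have [_ /(_ (delta_mx i 0))] := Df (delta_mx j 0); apply.
Qed.

Lemma pointed_eq (s s' : pointed R n) :
  carrier s = carrier s' -> base s = base s' -> s = s'.
Proof.
case: s => S b hS Sb; case: s' => S' b' hS' Sb' /= SS bb; subst S' b'.
by rewrite (Prop_irrelevance hS hS') (Prop_irrelevance Sb Sb').
Qed.

Lemma inv_orth phi : (rot phi)^T *m (rot phi)^T^T = 1%:M.
Proof. by rewrite trmxK (mulmx1C (rot_orth phi)). Qed.

Lemma inv_det phi : \det (rot phi)^T = 1.
Proof. by rewrite det_tr rot_det. Qed.

Definition inv_motion phi : motion R n :=
  Motion (- ((rot phi)^T *m trans phi)) (inv_orth phi) (inv_det phi).

Lemma move_inv phi q : move (inv_motion phi) q = (rot phi)^T *m (q - trans phi).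
Proof. by rewrite /move /= mulmxBr. Qed.

Lemma move_invK phi : cancel (move phi) (move (inv_motion phi)).
Proof.
by move=> q; rewrite move_inv /move addrK mulmxA (mulmx1C (rot_orth phi)) mul1mx.
Qed.

Lemma move_Kinv phi : cancel (move (inv_motion phi)) (move phi).
Proof. by move=> q; rewrite move_inv /move mulmxA rot_orth mul1mx subrK. Qed.

Lemma jact_invK phi (j : J2 R n) : jact (inv_motion phi) (jact phi j) = j.
Proof.
rewrite -[j]reprK -/(jet (repr j)) !jact_jet; congr jet; apply: pointed_eq => /=.
  by rewrite image_comp (eq_imagel (fun q _ => move_invK phi q)) image_id.
exact: move_invK.
Qed.

(** Invariance says that the image of [E] under the whole group is [E]; applied to
    the inverse motion, it makes each single motion preserve and reflect [E]. *)
Lemma SE_invariantP E phi (j : J2 R n) : SE_invariant E -> E (jact phi j) <-> E j.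
Proof.
move=> Einv; have Eact psi k : E k -> E (jact psi k).
  by move=> Ek; rewrite -Einv; exists psi => //; exists k.
by split=> [/(Eact (inv_motion phi))|]; [rewrite jact_invK|exact: Eact].
Qed.

Lemma graph_colE (f : lfun R n) (q : point R n) :
  graph f q <-> dom f (dsubmx q) /\ usubmx q = (f (dsubmx q))%:M.
Proof.
split=> [[y fy <-]|[fy qE]].
  by rewrite /gpoint col_mxKd col_mxKu.
by exists (dsubmx q) => //; rewrite /gpoint -qE vsubmxK.
Qed.

Lemma image_move phi (S : set (point R n)) q :
  (move phi @` S) q <-> S ((rot phi)^T *m (q - trans phi)).
Proof.
rewrite -move_inv; split=> [[r Sr <-]|Sq]; first by rewrite move_invK.
by exists (move (inv_motion phi) q) => //; exact: move_Kinv.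
Qed.

End Geometry.

(** * Quadrics that are graphs in two directions *)

Section DotProduct.
Variables (R : realType) (n : nat).
Implicit Types (x y z w t xi : 'cV[R]_n) (q : 'rV[R]_n).
Implicit Types (D H K : 'M[R]_n) (a b c : R).

Definition dot y z : R := (y^T *m z) 0 0.

Lemma dotC y z : dot y z = dot z y.
Proof. by rewrite /dot -[z^T *m y]trmxK trmx_mul trmxK [RHS]mxE. Qed.

Lemma dotDl y z w : dot (y + z) w = dot y w + dot z w.
Proof. by rewrite /dot linearD mulmxDl mxE. Qed.

Lemma dotDr y z w : dot w (y + z) = dot w y + dot w z.
Proof. by rewrite /dot mulmxDr mxE. Qed.

Lemma dotZl b y z : dot (b *: y) z = b * dot y z.
Proof. by rewrite /dot linearZ /= -scalemxAl mxE. Qed.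

Lemma dotZr b y z : dot z (b *: y) = b * dot z y.
Proof. by rewrite /dot -scalemxAr mxE. Qed.

Lemma dot_mulmx K y z : dot y (K *m z) = dot (K^T *m y) z.
Proof. by rewrite /dot trmx_mul trmxK mulmxA. Qed.

Lemma dot_ge0 y : 0 <= dot y y.
Proof. by rewrite /dot mxE sumr_ge0 // => i _; rewrite mxE -expr2 sqr_ge0. Qed.

Lemma dot_eq0 t : dot t t = 0 -> t = 0.
Proof.
move=> tt; have [//|t0] := eqVneq t 0.
have /sqnorm_gt0 : t^T != 0.
  by apply: contra_neq t0 => /(congr1 trmx); rewrite trmxK trmx0.
by rewrite trmxK -/(dot t t) tt ltxx.
Qed.

Lemma linE_dot q x y : lin q x y = dot q^T (y - x).
Proof. by rewrite /lin /dot trmxK. Qed.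

Lemma quadE_dot H x y : quad H x y = dot (y - x) (H *m (y - x)).
Proof. by rewrite /quad /dot mulmxA. Qed.

(** The choice of [c] cancels the terms quadratic in [s]. Hence the quadric with
    equation [v (1 + c t.y) = y.D y / 2] is a graph over the hyperplane [v = 0],
    and, in the direction of which [(a, t)] are the components, its equation is of
    first degree in [s]: it is also a graph with respect to that direction, with
    a rational function and without solving any implicit equation. *)
Lemma quadric_two_graphs a c t D H K :
  a != 0 -> D^T = D -> K^T *m D *m K = a *: H ->
  c * a * dot t t = dot t (D *m t) / 2 ->
  let m := K^T *m (c *: t - a^-1 *: (D *m t)) in
  forall s xi, let y := s *: t + K *m xi in
  1 + dot (c *: t) y != 0 -> 1 + dot m xi != 0 ->
  (a * s = dot y (D *m y) / 2 / (1 + dot (c *: t) y) <->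
   s = dot xi (H *m xi) / 2 / (1 + dot m xi)).
Proof.
move=> a0 Ds KDK ct m s xi y d1 d2.
(* The equation of the quadric in both coordinate systems. *)
have key : a * s * (1 + dot (c *: t) y) - dot y (D *m y) / 2 =
           a * (s * (1 + dot m xi) - dot xi (H *m xi) / 2).
  have E1 : dot y (D *m y) = s ^+ 2 * dot t (D *m t) +
      2 * s * dot (D *m t) (K *m xi) + a * dot xi (H *m xi).
    rewrite /y mulmxDr -scalemxAr !(dotDl, dotDr, dotZl, dotZr).
    rewrite (dot_mulmx D) Ds (dotC (K *m xi) (D *m t)).
    have -> : dot (K *m xi) (D *m (K *m xi)) = a * dot xi (H *m xi).
      by rewrite -dotZr scalemxAl -KDK [LHS]dotC [LHS]dot_mulmx [LHS]dotC !mulmxA.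
    by ring.
  have E2 : dot m xi = c * dot t (K *m xi) - a^-1 * dot (D *m t) (K *m xi).
    by rewrite /m -dot_mulmx dotDl dotZl -scaleN1r !dotZl; ring.
  rewrite E1 E2 dotZl /y dotDr dotZr.
  have -> : dot t (D *m t) = 2 * (c * a * dot t t) by rewrite ct; field.
  by field.
split=> sE.
  have e : a * s * (1 + dot (c *: t) y) = dot y (D *m y) / 2.
    by rewrite sE divfK.
  have /eqP := key; rewrite e subrr eq_sym mulf_eq0 (negPf a0) subr_eq0.
  by move=> /eqP <-; rewrite mulfK.
have e : s * (1 + dot m xi) = dot xi (H *m xi) / 2 by rewrite {1}sE divfK.
have /eqP := key; rewrite e subrr mulr0 subr_eq0.
by move=> /eqP <-; rewrite mulfK.
Qed.

End DotProduct.

Section Quadric.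
Variables (R : realType) (n : nat).
Variables (phi : motion R n) (x p t : 'cV[R]_n) (L D H : 'M[R]_n) (a c u : R).
(* The first column [a (1, -p)] of the rotation is normal to the graph of [f] at
   [x], and [K] maps the parameters [xi] to components along the other columns. *)
Hypotheses (transE : trans phi = col_mx u%:M x)
  (rotE : rot phi = block_mx a%:M t^T (- a *: p) L).
Let K := t *m p^T + L^T.
Hypotheses (a0 : a != 0) (Ds : D^T = D) (KDK : K^T *m D *m K = a *: H)
  (ct : c * a * dot t t = dot t (D *m t) / 2).
Let m := K^T *m (c *: t - a^-1 *: (D *m t)).
Let f' := osculant_fun 0 0 0 D (c *: t).
Let f := osculant_fun x u p H m.

(** [M *m (q - q0)] stands for a block of coordinates of [q - q0] in some frame. *)
Lemma near_den k (M : 'M[R]_(n, 1 + n)) (q0 : point R n) :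
  \forall q \near q0, 1 + dot k (M *m (q - q0)) != 0.
Proof.
have d0 : den (k^T *m M)^T q0 q0 != 0 by rewrite den_center oner_eq0.
apply: filterS (open_nbhs_nbhs (conj (@den_open _ _ _ _) d0)) => q /=.
by rewrite /den trmxK /lin /dot mulmxA.
Qed.

(** In coordinates [(v, y)] adapted to the motion, a point [(r, x + xi)] has
    [v = a s] and [y = s t + K xi], where [s = r - u - p.xi] is its height above
    the tangent hyperplane; then [quadric_two_graphs] applies wherever both
    denominators are nonzero. *)
Lemma quadric_local_graph :
  \forall q \near (col_mx u%:M x : point R n),
    (move phi @` graph f') q <-> graph f q.
Proof.
set q0 : point R n := col_mx u%:M x.
have n1 := near_den (c *: t) (dsubmx (rot phi)^T) q0.
have n2 := near_den m (dsubmx (1%:M : 'M_(1 + n))) q0.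
apply: filterS2 n1 n2 => q d1 d2.
pose r := usubmx q 0 0; pose xi := dsubmx q - x; pose s := r - u - dot p xi.
have uE : usubmx q = r%:M by rewrite [LHS]mx11_scalar.
have dqE : q - q0 = col_mx (r - u)%:M xi.
  by rewrite -{1}[q]vsubmxK uE /q0 opp_col_mx add_col_mx -raddfB.
have pxiE : p^T *m xi = (dot p xi)%:M by rewrite [LHS]mx11_scalar.
have wE : (rot phi)^T *m (q - q0) = col_mx (a * s)%:M (s *: t + K *m xi).
  rewrite dqE rotE tr_block_mx mul_block_col trmxK tr_scalar_mx.
  rewrite linearZ /= -scalemxAl pxiE -scalar_mxM scale_scalar_mx -raddfD.
  congr (col_mx _%:M _); first by rewrite /s; ring.
  rewrite mul_mx_scalar /K mulmxDl -mulmxA pxiE mul_mx_scalar addrA -scalerDl.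
  by rewrite /s subrK.
have {}d1 : 1 + dot (c *: t) (s *: t + K *m xi) != 0.
  by move: d1; rewrite mul_dsub_mx wE col_mxKd.
have {}d2 : 1 + dot m xi != 0.
  by move: d2; rewrite mul_dsub_mx mul1mx dqE col_mxKd.
rewrite image_move transE !graph_colE -/q0 wE col_mxKd col_mxKu uE /=.
rewrite /osculant /den !linE_dot !trmxK !quadE_dot !subr0 -/xi.
have := quadric_two_graphs a0 Ds KDK ct d1 d2; rewrite -/m => twoE.
have -> : dot 0 (s *: t + K *m xi) = 0 by rewrite /dot trmx0 mul0mx mxE.
have scalar1_inj (b d : R) : b%:M = d%:M :> 'M_1 -> b = d.
  by move=> /matrixP/(_ 0 0); rewrite !mxE eqxx !mulr1n.
rewrite !add0r; split=> [[_ /scalar1_inj/twoE sE]|[_ /scalar1_inj rE]].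
  by split=> //; congr (_%:M); rewrite -sE /s; ring.
by split=> //; congr (_%:M); apply/twoE; rewrite /s rE; ring.
Qed.

End Quadric.

(** * Rotating the tangent hyperplane to the horizontal *)

Section Rotation.
Variables (R : realType) (n : nat).
Implicit Types (p v w : 'cV[R]_n) (B : 'M[R]_n).

(** Both sides are the determinant of the matrix [M] of the proof, by elimination
    of its lower left, respectively upper right, block. *)
Lemma det_add_outer v w : \det (1%:M + v *m w^T) = 1 + dot w v.
Proof.
pose M : 'M[R]_(1 + n) := block_mx 1%:M (- w^T) v 1%:M.
have e1 : block_mx 1%:M 0 (- v) 1%:M *m M =
    block_mx 1%:M (- w^T) 0 (1%:M + v *m w^T).
  rewrite mulmx_block !mulmx1 !mul1mx !mul0mx !addr0 mulNmx mulmxN opprK.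
  by rewrite addNr addrC.
have e2 : block_mx 1%:M w^T 0 1%:M *m M =
    block_mx (1 + dot w v)%:M 0 v 1%:M.
  rewrite mulmx_block !mulmx1 !mul1mx !mul0mx !add0r addNr.
  by rewrite [w^T *m v]mx11_scalar -raddfD.
have := congr1 determinant e1.
rewrite det_mulmx det_lblock det_ublock !det1 !mul1r => <-.
have := congr1 determinant e2.
rewrite det_mulmx det_lblock det_ublock !det1 !mul1r.
by rewrite mulr1 det_scalar1.
Qed.

(** The cosine of the angle between the normal to the graph and the [u]-axis. *)
Definition normal_cos p : R := (Num.sqrt (1 + dot p p))^-1.

Lemma normal_cos_gt0 p : 0 < normal_cos p.
Proof. by rewrite invr_gt0 sqrtr_gt0 ltr_pwDl // dot_ge0. Qed.

Lemma dot_normal_cos p : dot p p = (normal_cos p) ^- 2 - 1.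
Proof.
rewrite /normal_cos exprVn invrK sqr_sqrtr; first by ring.
by rewrite addr_ge0 // dot_ge0.
Qed.

(** The symmetric square root of the first fundamental form [1 + p p^T]: it sends
    [xi] to the components of the tangent vector [(p.xi, xi)] in the orthonormal
    frame of the tangent hyperplane that [tilt_mx] provides. *)
Definition tangent_mx p : 'M[R]_n :=
  1%:M + (normal_cos p / (1 + normal_cos p)) *: (p *m p^T).

Lemma tangent_mxE p : let a := normal_cos p in
  a *: (p *m p^T) + (1%:M - (a ^+ 2 / (1 + a)) *: (p *m p^T)) = tangent_mx p.
Proof.
rewrite /tangent_mx /= addrCA; congr (_ + _).
rewrite -scaleNr -scalerDl; congr (_ *: _); field.
by rewrite gt_eqF // addr_gt0 // normal_cos_gt0.
Qed.

(** The rotation in the plane spanned by the [u]-axis and the gradient [p] that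
    takes the [u]-axis to the unit normal [a (1, -p)]. *)
Definition tilt_mx p : 'M[R]_(1 + n) :=
  let a := normal_cos p in
  block_mx a%:M (a *: p)^T (- a *: p)
    (1%:M - (a ^+ 2 / (1 + a)) *: (p *m p^T)).

Lemma outer_sqr p : p *m p^T *m (p *m p^T) = dot p p *: (p *m p^T).
Proof.
rewrite mulmxA -(mulmxA p) [p^T *m p]mx11_scalar mul_mx_scalar.
by rewrite -scalemxAl.
Qed.

Lemma outer_trmx p : (p *m p^T)^T = p *m p^T.
Proof. by rewrite trmx_mul trmxK. Qed.

Lemma tangent_mx_sym p : (tangent_mx p)^T = tangent_mx p.
Proof. by rewrite /tangent_mx linearD /= trmx1 linearZ /= outer_trmx. Qed.

Lemma tangent_mx_sqr p : tangent_mx p *m tangent_mx p = 1%:M + p *m p^T.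
Proof.
have a0 := normal_cos_gt0 p; have a1 : 1 + normal_cos p != 0.
  by rewrite gt_eqF // ltr_wpDl // ltW.
rewrite /tangent_mx; set q := p *m p^T; set k := normal_cos p / _.
rewrite mulmxDl mul1mx mulmxDr mulmx1 -scalemxAl -scalemxAr outer_sqr -/q.
rewrite -addrA !scalerA -!scalerDl.
rewrite (_ : k + _ = 1) ?scale1r // /k dot_normal_cos.
by field; rewrite a1 gt_eqF.
Qed.

Lemma det_tangent_mx p : \det (tangent_mx p) = (normal_cos p)^-1.
Proof.
have a0 := normal_cos_gt0 p; have a1 : 1 + normal_cos p != 0.
  by rewrite gt_eqF // ltr_wpDl // ltW.
rewrite /tangent_mx scalemxAl det_add_outer dotZr dot_normal_cos.
by field; rewrite a1 gt_eqF.
Qed.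

Lemma tilt_mx_orth p : tilt_mx p *m (tilt_mx p)^T = 1%:M.
Proof.
have a0 := normal_cos_gt0 p; have a1 : 1 + normal_cos p != 0.
  by rewrite gt_eqF // ltr_wpDl // ltW.
have ppE := dot_normal_cos p.
rewrite /tilt_mx /=; set a := normal_cos p in a0 a1 ppE *.
set k := a ^+ 2 / (1 + a); set L := 1%:M - k *: (p *m p^T).
have pp : p^T *m p = (dot p p)%:M by rewrite [LHS]mx11_scalar.
have LT : L^T = L by rewrite /L linearB /= trmx1 linearZ /= outer_trmx.
have Lp : L *m p = a *: p.
  rewrite /L mulmxBl mul1mx -scalemxAl -mulmxA pp mul_mx_scalar scalerA.
  rewrite -[X in X - _]scale1r -scalerBl ppE; congr (_ *: _).
  by rewrite /k; field; rewrite a1 gt_eqF.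
have pL : p^T *m L = a *: p^T.
  by rewrite -[LHS]trmxK trmx_mul trmxK LT Lp linearZ.
have LL : L *m L = 1%:M - a ^+ 2 *: (p *m p^T).
  rewrite {2}/L mulmxBr mulmx1 -scalemxAr mulmxA Lp -scalemxAl scalerA.
  rewrite /L -addrA -opprD -scalerDl; congr (1%:M - _ *: _).
  by rewrite /k; field.
rewrite tr_block_mx mulmx_block trmxK LT LL tr_scalar_mx.
have -> : (a *: p)^T = a *: p^T by rewrite linearZ.
have -> : (- a *: p)^T = - a *: p^T by rewrite linearZ.
rewrite [RHS]scalar_mx_block; congr block_mx.
- rewrite -scalemxAl -scalemxAr pp scalerA -scalar_mxM scale_scalar_mx -raddfD.
  by congr (_%:M); rewrite ppE; field; rewrite gt_eqF.
- by rewrite mul_scalar_mx -scalemxAl pL !scalerA mulrN scaleNr addNr.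
- by rewrite mul_mx_scalar -scalemxAr Lp !scalerA mulrN scaleNr addNr.
rewrite -scalemxAl -scalemxAr scalerA mulrNN -expr2 addrCA.
by rewrite subrr addr0.
Qed.

Lemma det_tilt_mx p : \det (tilt_mx p) = 1.
Proof.
(* Row elimination leaves the Schur complement [tangent_mx p]. *)
have a0 := normal_cos_gt0 p; have e : block_mx 1%:M 0 p 1%:M *m tilt_mx p =
    block_mx (normal_cos p)%:M (normal_cos p *: p)^T 0 (tangent_mx p).
  rewrite /tilt_mx /= mulmx_block !mul1mx !mul0mx !addr0.
  rewrite mul_mx_scalar scaleNr subrr; congr block_mx.
  by rewrite linearZ /= -scalemxAr tangent_mxE.
have := congr1 determinant e.
rewrite det_mulmx det_lblock det_ublock !det1 !mul1r => ->.
by rewrite det_tangent_mx det_scalar1 divff // gt_eqF.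
Qed.

End Rotation.

Section NormalForm.
Variables (R : realType) (n : nat).
Implicit Types (t x : 'cV[R]_n) (D L : 'M[R]_n).

(** The 2-jet of [f] at [x] is that of a rotated quadric which, in coordinates
    adapted to its tangent hyperplane, has the 2-jet [(0, 0, D)]. Only one step of
    the relation generating the jets is used: in the original coordinates, the
    rotated quadric is the graph of an [osculant] with the 2-jet of [f]. *)
Lemma jet_normal_form (f : lfun R n) x (fx : dom f x) phi t L D (a : R) :
  let p := (coords f x).1.2 in let H := (coords f x).2 in
  let K := t *m p^T + L^T in
  trans phi = gpoint f x ->
  rot phi = block_mx a%:M t^T (- a *: p) L -> a != 0 ->
  D^T = D -> K^T *m D *m K = a *: H ->
  exists m, jet_graph fx = jact phi (jet_graph (osculant_dom 0 0 0 D m)).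
Proof.
move=> p H K phiT phiR a0 Ds KDK.
(* If [t = 0], no condition is imposed on [c], and [x / 0 = 0] does no harm. *)
pose c := dot t (D *m t) / 2 / (a * dot t t).
have ct : c * a * dot t t = dot t (D *m t) / 2.
  rewrite -mulrA /c; have [tt|tt] := eqVneq (dot t t) 0.
    by rewrite (dot_eq0 tt) /dot !mulmx0 mxE !(mulr0, mul0r).
  by rewrite divfK // mulf_neq0.
exists (c *: t); rewrite /jet_graph jact_jet.
apply/eqmodP/asboolP/rst_step.
pose g := osculant_fun x (f x) p H (K^T *m (c *: t - a^-1 *: (D *m t))).
have gx : g x = f x by exact: osculant_center.
have gpE : gpoint g x = gpoint f x by rewrite /gpoint gx.
exists (motion1 R n), f, g, x; split => /=.
- by rewrite move1.
- by split=> //; near=> q; rewrite move1.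
- rewrite move1 gpE /move phiT /gpoint /= osculant_center.
  by rewrite raddf0 col_mx0 mulmx0 add0r.
- split; first exact: osculant_dom.
  rewrite gpE /gpoint; near=> q; rewrite move1.
  near: q; exact: quadric_local_graph.
by rewrite coords_osculant //; exact: hessian_sym.
Unshelve. all: by end_near. Qed.

End NormalForm.

(** * Principal axes *)

Section Diagonalisation.
Variables (R : realType) (n : nat).
Implicit Types (p x : 'cV[R]_n) (B H : 'M[R]_n) (l : 'rV[R]_n).

(** If [B] has determinant [-1], change the sign of its first column: a sign matrix
    commutes with the diagonal matrix. *)
Lemma special_orthogonal B l : B *m B^T = 1%:M ->
  exists B', [/\ B' *m B'^T = 1%:M, \det B' = 1
    & B' *m diag_mx l *m B'^T = B *m diag_mx l *m B^T].
Proof.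
move=> BB; have [|detB] := eqVneq (\det B) 1; first by exists B.
have {detB} detB : \det B = -1.
  have /eqP := congr1 determinant BB.
  by rewrite det_mulmx det_tr det1 -expr2 sqrf_eq1 (negPf detB) /= => /eqP.
case: n B l BB detB => [|m] B l BB detB.
  by have := ltrN10 R; rewrite -detB det_mx00 ltr10.
pose e : 'rV[R]_m.+1 := \row_i (if i == ord0 then -1 else 1).
have eM : diag_mx e *m diag_mx l *m diag_mx e = diag_mx l.
  rewrite !mulmx_diag; congr diag_mx; apply/rowP => i; rewrite !mxE.
  by case: eqP => _; rewrite ?mulN1r ?mulrN1 ?opprK ?mul1r ?mulr1.
have ee : diag_mx e *m diag_mx e = 1%:M.
  rewrite mulmx_diag -diag_const_mx; congr diag_mx; apply/rowP => i; rewrite !mxE.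
  by case: eqP => _; rewrite ?mulN1r ?opprK ?mul1r.
exists (B *m diag_mx e); split.
- by rewrite trmx_mul tr_diag_mx mulmxA -(mulmxA B) ee mulmx1.
- rewrite det_mulmx detB det_diag big_ord_recl big1 => [|i _]; last by rewrite mxE.
  by rewrite mxE eqxx mulr1 mulrNN mulr1.
by rewrite trmx_mul tr_diag_mx !mulmxA -(mulmxA B) -(mulmxA B) eM.
Qed.

Lemma diag_mx_perm (s : 'S_n) B l : B *m B^T = 1%:M ->
  exists2 B', B' *m B'^T = 1%:M
    & B' *m diag_mx (\row_i l 0 (s i)) *m B'^T = B *m diag_mx l *m B^T.
Proof.
move=> BB; pose P : 'M[R]_n := perm_mx s.
have PP : P *m P^T = 1%:M by rewrite /P tr_perm_mx -perm_mxM mulgV perm_mx1.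
have PP' := mulmx1C PP.
have -> : diag_mx (\row_i l 0 (s i)) = P *m diag_mx l *m P^T.
  rewrite /P tr_perm_mx -row_permE -col_permE.
  by apply/matrixP => i j; rewrite !mxE (inj_eq perm_inj).
exists (B *m P^T).
  by rewrite trmx_mul trmxK mulmxA -(mulmxA B) PP' mulmx1.
rewrite trmx_mul trmxK !mulmxA -(mulmxA B) PP' mulmx1.
by rewrite -(mulmxA _ P^T) PP' mulmx1.
Qed.

(** The matrix of the shape operator in the orthonormal frame [tilt_mx p] of the
    tangent hyperplane. It is symmetric, unlike the matrix in the coordinate
    basis. *)
Definition frame_operator p H : 'M[R]_n :=
  invmx (tangent_mx p) *m (normal_cos p *: H) *m invmx (tangent_mx p).

Lemma tangent_mx_unit p : tangent_mx p \in unitmx.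
Proof.
by rewrite unitmxE det_tangent_mx unitfE invr_neq0 // gt_eqF // normal_cos_gt0.
Qed.

Lemma frame_operator_sym p H :
  H^T = H -> (frame_operator p H)^T = frame_operator p H.
Proof.
move=> Hs; rewrite /frame_operator !trmx_mul linearZ /= Hs trmx_inv.
by rewrite tangent_mx_sym mulmxA.
Qed.

Lemma shape_operatorE (f : lfun R n) x :
  let p := (coords f x).1.2 in
  shape_operator f x = invmx (tangent_mx p) *m
    frame_operator p (coords f x).2 *m tangent_mx p.
Proof.
move=> p; rewrite /shape_operator /second_form /first_form -/p.
have -> : (Num.sqrt (\det (1%:M + p *m p^T)))^-1 = normal_cos p.
  by rewrite det_add_outer.
have Ku := tangent_mx_unit p; rewrite -tangent_mx_sqr.
set K := tangent_mx p in Ku *.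
have -> : invmx (K *m K) = invmx K *m invmx K.
  have KKu : K *m K \in unitmx by rewrite unitmx_mul Ku.
  rewrite -[LHS]mulmx1 -[RHS](mulKmx KKu); congr (_ *m _).
  by rewrite mulmxA -(mulmxA K K) mulmxV // mulmx1 mulmxV.
by rewrite /frame_operator -/K !mulmxA mulmxKV.
Qed.

(** Composing [tilt_mx] with the rotation [B] of the tangent hyperplane makes the
    quadratic form of the normal form diagonal. *)
Lemma jet_diagonal (f : lfun R n) x (fx : dom f x) B l :
  B *m B^T = 1%:M -> \det B = 1 ->
  frame_operator (coords f x).1.2 (coords f x).2 = B *m diag_mx l *m B^T ->
  exists phi m,
    jet_graph fx = jact phi (jet_graph (osculant_dom 0 0 0 (diag_mx l) m)).
Proof.
set p := _.1.2; set H := _.2 => BB detB WE.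
pose Q : 'M[R]_(1 + n) := block_mx 1%:M 0 0 B.
have orthM : (tilt_mx p *m Q) *m (tilt_mx p *m Q)^T = 1%:M.
  rewrite trmx_mul mulmxA -(mulmxA (tilt_mx p)) block1_orthogonal //.
  by rewrite mulmx1 tilt_mx_orth.
have detM : \det (tilt_mx p *m Q) = 1.
  by rewrite det_mulmx det_tilt_mx det_lblock det1 detB !mul1r.
pose phi := Motion (gpoint f x) orthM detM.
exists phi; apply: (@jet_normal_form _ _ f x fx phi
  (normal_cos p *: (B^T *m p)) (_ *m B) (diag_mx l) (normal_cos p)) => //.
- rewrite /= /tilt_mx mulmx_block !mulmx0 !mulmx1 addr0 !add0r addr0.
  congr block_mx.
  by rewrite !linearZ /= trmx_mul trmxK -scalemxAl.
- by rewrite gt_eqF // normal_cos_gt0.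
- exact: tr_diag_mx.
rewrite -/p -/H; set a := normal_cos p; set q := 1%:M - _.
have -> : (a *: (B^T *m p)) *m p^T + (q *m B)^T = B^T *m tangent_mx p.
  rewrite trmx_mul -scalemxAl -mulmxA scalemxAr -mulmxDr; congr (_ *m _).
  by rewrite /q linearB /= trmx1 linearZ /= outer_trmx tangent_mxE.
rewrite trmx_mul trmxK tangent_mx_sym !mulmxA -(mulmxA _ B) -(mulmxA _ _ B^T) -WE.
rewrite /frame_operator !mulmxA mulmxV ?tangent_mx_unit // mul1mx.
by rewrite mulmxKV ?tangent_mx_unit.
Qed.

End Diagonalisation.

(** * The invariant equation *)

Section Conclusion.
Variables (R : realType) (n : nat).

Lemma trace_power_conj (K B A : 'M[R]_n) (l : 'rV[R]_n) k :
  K \in unitmx -> B *m B^T = 1%:M ->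
  A = invmx K *m (B *m diag_mx l *m B^T) *m K ->
  \tr (A ^+ k) = \sum_i l 0 i ^+ k.
Proof.
move=> Ku BB AE; pose Y := invmx K *m B; pose Z := B^T *m K.
have ZY : Z *m Y = 1%:M.
  by rewrite /Z /Y mulmxA mulmxK // (mulmx1C BB).
have YZ := mulmx1C ZY.
have {}AE : A = Y *m diag_mx l *m Z by rewrite AE /Y /Z !mulmxA.
clearbody Y Z.
have -> : A ^+ k = Y *m diag_mx (\row_i l 0 i ^+ k) *m Z.
  elim: k => [|k IH].
    rewrite expr0 (_ : diag_mx _ = 1%:M) ?mulmx1 ?YZ //.
    by apply/matrixP => i j; rewrite !mxE.
  rewrite exprS IH -[LHS]/(A *m _) AE.
  rewrite !mulmxA -(mulmxA _ Z Y) ZY mulmx1 -(mulmxA Y (diag_mx l)) mulmx_diag.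
  congr (_ *m diag_mx _ *m _); by apply/rowP => i; rewrite !mxE exprS.
rewrite mxtrace_mulC mulmxA ZY mul1mx mxtrace_diag.
by apply: eq_bigr => i _; rewrite mxE.
Qed.

(** Every jet in normal form lies over the single point [((0, 0), 0)], so of the
    polynomials that define [E] only the one over that point is needed. *)
Lemma invariant_equation (E : set (J2 R n)) :
  SE_invariant E -> polynomial_in_second_derivatives E ->
  exists P : mpoly.mpoly (n * n) R,
    forall (f : lfun R n) (x : 'cV[R]_n) (fx : dom f x) B l,
      B *m B^T = 1%:M ->
      frame_operator (coords f x).1.2 (coords f x).2 = B *m diag_mx l *m B^T ->
      E (jet_graph fx) <-> mpoly.meval (mxvec (diag_mx l) 0) P = 0.
Proof.
move=> Einv [d [P [_ EP]]]; exists (P (col_mx 0%:M 0, 0)) => f x fx B l BB WE.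
have [B' [BB' detB' B'E]] := special_orthogonal l BB.
rewrite -B'E in WE; have [phi [m ->]] := jet_diagonal fx BB' detB' WE.
rewrite SE_invariantP // EP coords_osculant //; exact: tr_diag_mx.
Qed.

End Conclusion.

Theorem theorem4p1 (R : realType) (n : nat) (E : set (J2 R n))
    (E_PDE : second_order_PDE E)
    (E_inv : SE_invariant E)
    (E_poly : polynomial_in_second_derivatives E) :
  exists F : mpoly.mpoly n R,
    forall (f : lfun R n) (x : 'cV[R]_n) (fx : dom f x),
      E (jet_graph fx) <->
      mpoly.meval (fun k : 'I_n => \tr (shape_operator f x ^+ k.+1)) F = 0.
Proof.
have [P PE] := invariant_equation E_inv E_poly.
have [G GE] := diag_symmetrize_power_sums P.
exists G => f x fx; set W := frame_operator (coords f x).1.2 (coords f x).2.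
have Ws : W^T = W by apply: frame_operator_sym; exact: hessian_sym.
have [B [l [BB WE]]] := symmetric_spectral Ws.
have -> : mpoly.meval (fun k : 'I_n => \tr (shape_operator f x ^+ k.+1)) G =
    mpoly.meval (fun k : 'I_n => \sum_i l 0 i ^+ k.+1) G.
  apply: mpoly.meval_eq => k.
  apply: (trace_power_conj k.+1 (tangent_mx_unit (coords f x).1.2) BB).
  by rewrite -WE shape_operatorE.
(* All orders of the eigenvalues are available, since each of them diagonalises
   the same [W]. *)
rewrite -GE; split=> [Ef s|h].
  have [B' BB' B'E] := diag_mx_perm s l BB.
  by apply/(PE f x fx B') => //; rewrite B'E.
apply/(PE f x fx B l) => //; have := h 1%g.
rewrite (_ : \row_i _ = l) //; apply/rowP => i.
by rewrite mxE perm1.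
Qed.
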